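(* Let $n\ge 1$, let each $C_i\subset\mathbb{C}$, $1\le i\le n$, be an open disc or the (open) exterior of a disc, and let $f,g\in\mathbb{C}_\kappa[z_1,\ldots,z_n]$, where $\kappa=(\kappa_1,\ldots,\kappa_n)\in\mathbb{N}^n$. Suppose that (i) $f$ is $C_1\times\cdots\times C_n$-stable and $\deg_{z_j}(f)=\kappa_j$ whenever $C_j$ is the exterior of a disc, and (ii) $g$ is $(\mathbb{C}\setminus C_1)\times\cdots\times(\mathbb{C}\setminus C_n)$-stable and $\deg_{z_j}(g)=\kappa_j$ whenever $C_j$ is a disc. Then $\{f,g\}_\kappa\ne 0$.
   Context: $\mathbb{N}=\{0,1,2,\ldots\}$. For $\Omega\subset\mathbb{C}^n$, a polynomial $f\in\mathbb{C}[z_1,\ldots,z_n]$ is $\Omega$-stable if $f(z_1,\ldots,z_n)\neq 0$ whenever $(z_1,\ldots,z_n)\in\Omega$. $\mathbb{C}_\kappa[z_1,\ldots,z_n]$ is the space of polynomials $f\in\mathbb{C}[z_1,\ldots,z_n]$ with $\deg_{z_i}(f)\le\kappa_i$ for $1\le i\le n$, where $\deg_{z_i}(f)$ denotes the degree of $f$ in $z_i$. For $f,g\in\mathbb{C}[z_1,\ldots,z_n]$ and $\kappa\in\mathbb{N}^n$, $$\{f,g\}_\kappa:=\sum_{\alpha\le\kappa}(-1)^{\alpha}f^{(\alpha)}(0)\,g^{(\kappa-\alpha)}(0),$$ where the sum is over $\alpha\in\mathbb{N}^n$ with $\alpha_i\le\kappa_i$ for all $i$, $(-1)^\alpha=(-1)^{\alpha_1+\cdots+\alpha_n}$,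 and $f^{(\alpha)}=\frac{\partial^{\alpha_1+\cdots+\alpha_n}f}{\partial z_1^{\alpha_1}\cdots\partial z_n^{\alpha_n}}$. *)

(* Defs.v *)
From HB Require Import structures.
From mathcomp Require Export all_boot all_order all_algebra.
From mathcomp Require Export classical_sets reals.
From mathcomp Require Export complex.
From mathcomp Require Export mpoly.

Set Implicit Arguments.
Unset Strict Implicit.
Unset Printing Implicit Defensive.

Import Order.TTheory GRing.Theory Num.Theory.

Local Open Scope ring_scope.
Local Open Scope complex_scope.
Local Open Scope classical_set_scope.

(* [R[i]], for [R] a model of the real numbers, is the field of complex
   numbers; its norm takes values in [R[i]], whence the embedding [r%:C]. *)

Definition is_open_disc (R : realType) (D : set R[i]) : Prop :=
  exists (c : R[i]) (r : R), 0 < r /\ D = [set z | `|z - c| < r%:C].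

Definition is_disc_exterior (R : realType) (D : set R[i]) : Prop :=
  exists (c : R[i]) (r : R), 0 < r /\ D = [set z | r%:C < `|z - c|].

Definition set_prod (R : realType) (n : nat) (C : 'I_n -> set R[i]) :
    set ('I_n -> R[i]) :=
  [set z | forall i, C i (z i)].

Definition stable (R : realType) (n : nat) (Omega : set ('I_n -> R[i]))
    (f : {mpoly R[i][n]}) : Prop :=
  forall z, Omega z -> f.@[z] != 0.

(* The zero polynomial gets degree 0. *)
Definition deg_in (R : realType) (n : nat) (i : 'I_n)
    (f : {mpoly R[i][n]}) : nat :=
  \max_(m <- msupp f) m i.

Definition deg_bounded (R : realType) (n : nat) (k : 'X_{1..n})
    (f : {mpoly R[i][n]}) : Prop :=
  forall i, (deg_in i f <= k i)%N.

(* The bound [mdeg a < (mdeg k).+1] only makes the index type finite: it is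
   implied by the componentwise order [a <= k]. *)
Definition apolar_form (R : realType) (n : nat) (k : 'X_{1..n})
    (f g : {mpoly R[i][n]}) : R[i] :=
  \sum_(a : 'X_{1..n < (mdeg k).+1} | (a <= k)%MM)
    (-1) ^+ mdeg a * (f^`M[a]).@[fun=> 0] * (g^`M[k - a]).@[fun=> 0].

(* Main.v *)
(* Charts [u |-> c_i + r_i u] or [u |-> c_i + r_i / u], the second kind
   homogenized in degree [k_i], turn [f] into a polynomial [F] without zeros in
   the open unit polydisc and, with the two kinds exchanged, [g] into a
   polynomial [G] without zeros in the closed one; the degree conditions and
   Hurwitz's theorem are what allows the point [u_i = 0] in charts of the second
   kind. By compactness [G] has no zeros in a polydisc of some radius
   [rho > 1]. In these coordinates the form is a product of one-variable pairings
   [sum_m (-1)^m p_m q_m / binom(k, m)], up to a nonzero factor, so that it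
   suffices to start from [F(u) G(v)] and to replace, one index [i] at a time,
   evaluation at [(u_i, v_i)] by the pairing. That this preserves nonvanishing
   is Grace's theorem for two-variable polynomials that need not be products:
   Laguerre's theorem polarizes one variable on each side, and an Asano
   contraction removes the two new variables, which lowers the degree by one.
   It is this non-product step that needs [rho > 1] rather than a closed disc:
   [1 + z w] has no zeros on [|z| < 1, |w| <= 1], but its pairing is [0]. *)

Require Import Defs.
From mathcomp Require Import ring zify.

Set Implicit Arguments.
Unset Strict Implicit.
Unset Printing Implicit Defensive.

Import Order.TTheory GRing.Theory Num.Theory.

Local Open Scope ring_scope.

(** * Grace's theorem on the unit disc *)

Section DiscGrace.
Variable K : numClosedFieldType.
Implicit Types (p q : {poly K}) (x y z w r : K).

(** With [t = rho^2], [e] is the rotated quotient [(y - r) / (x - r)] times [|x - r|^2]. For [x],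
    [y] inside and [r] outside the disc of radius [rho], the first two terms on the right are
    positive and the last is nonnegative. *)
Lemma laguerre_identity x y r (t : K) : t^* = t ->
  let e := (t - y^* * x) * (y - r) * (x - r)^* in
  e + e^* = (t - x * x^*) * ((y - r) * (y - r)^*)
          + (t - y * y^*) * ((x - r) * (x - r)^*)
          + (r * r^* - t) * ((y - x) * (y - x)^*).
Proof. by move=> tR /=; rewrite !(rmorphM, rmorphB) /= !conjCK tR; ring. Qed.

(** The copies of [e] stand for the roots at infinity of a polynomial of degree less than [k];
    [0 < k] keeps the sum from being empty. *)
Lemma Re_sum_gt0 (s : seq K) (e : K) :
  0 < e + e^* -> {in s, forall u, 0 < u + u^*} -> forall k, (size s <= k)%N -> (0 < k)%N ->
  0 < (\sum_(u <- s) u + e *+ (k - size s)) + (\sum_(u <- s) u + e *+ (k - size s))^*.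
Proof.
move=> e_gt0; elim: s => [|u s IH] hs k /= hk k_gt0.
  rewrite big_nil add0r subn0 rmorphMn -mulrnDl /=.
  by rewrite pmulrn_lgt0.
rewrite big_cons -[u + _ + _]addrA rmorphD /= addrACA.
have u_gt0 : 0 < u + u^* by apply: hs; rewrite mem_head.
case: k hk k_gt0 => // k hk _; rewrite subSS.
case: (posnP k) => [k0|k_gt0].
  have s0 : s = [::] by apply/nilP; rewrite /nilp -leqn0 -k0.
  by rewrite s0 k0 big_nil subnn mulr0n add0r rmorph0 addr0 addr0.
by apply: addr_gt0 => //; apply: IH => // v vs; apply: hs; rewrite in_cons vs orbT.
Qed.

Lemma horner_deriv_prod_XsubC (s : seq K) x : x \notin s ->
  (\prod_(r <- s) ('X - r%:P))^`().[x] =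
  (\prod_(r <- s) ('X - r%:P)).[x] * \sum_(r <- s) (x - r)^-1.
Proof.
elim: s => [|r s IH]; first by rewrite !big_nil derivC !hornerE.
rewrite in_cons negb_or => /andP[xr /IH {}IH].
rewrite !big_cons derivM derivXsubC mul1r hornerD !hornerM IH hornerXsubC mulrDr.
have : x - r != 0 by rewrite subr_eq0.
by move=> h; field.
Qed.

(* Divided by [p x], the left-hand side is [k - d] plus the sum of
   [(y - r) / (x - r)] over the [d] roots [r]. For [|r| >= rho] these numbers
   lie in a disc not containing [0]; the factor [rho^2 - y^* x] rotates
   it into the right half-plane. *)
Lemma laguerre p (k : nat) (rho : K) x y : (0 < k)%N -> (size p <= k.+1)%N ->
  (forall z, `|z| < rho -> p.[z] != 0) -> `|x| < rho -> `|y| < rho ->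
  k%:R * p.[x] + (y - x) * p^`().[x] != 0.
Proof.
move=> k_gt0 szp p_neq0 xrho yrho.
have rho_gt0 : 0 < rho by apply: le_lt_trans xrho.
have [rs rsE] := closed_field_poly_normal p.
have lc_neq0 : lead_coef p != 0.
  by apply: contraNneq (p_neq0 x xrho) => l0; rewrite rsE l0 scale0r horner0.
have rs_ge r : r \in rs -> rho <= `|r|.
  move=> rrs; rewrite real_leNgt ?normr_real ?gtr0_real //.
  apply/negP => /p_neq0; rewrite rsE hornerZ horner_prod (big_rem r) //=.
  by rewrite hornerXsubC subrr mul0r mulr0 eqxx.
have szrs : (size rs <= k)%N.
  by move: szp; rewrite rsE size_scale // size_prod_XsubC ltnS.
have xrs : x \notin rs.
  by apply/negP => /rs_ge; rewrite lt_geF.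
have P_neq0 : (\prod_(r <- rs) ('X - r%:P)).[x] != 0.
  by have := p_neq0 x xrho; rewrite rsE hornerZ mulf_eq0 negb_or => /andP[].
rewrite rsE derivZ !hornerZ horner_deriv_prod_XsubC //.
set P := _.[x] in P_neq0 *; set S := \sum_(_ <- _) _.
have -> : k%:R * (lead_coef p * P) + (y - x) * (lead_coef p * (P * S)) =
   lead_coef p * P * (k%:R + (y - x) * S) by ring.
rewrite !mulf_neq0 //.
have sqr z : z * z^* = `|z| ^+ 2 by rewrite normCK.
have rhoR : (rho ^+ 2)^* = rho ^+ 2 by rewrite rmorphXn /= conj_Creal // gtr0_real.
have sq_lt z : `|z| < rho -> 0 < rho ^+ 2 - z * z^*.
  by move=> zr; rewrite sqr subr_gt0 ltr_pXn2r ?nnegrE // ltW.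
set om := rho ^+ 2 - y^* * x.
have om_gt0 : 0 < om + om^*.
  have -> : om + om^* = (rho ^+ 2 - x * x^*) + (rho ^+ 2 - y * y^*) + (x - y) * (x - y)^*.
    by rewrite /om !rmorphB /= rhoR rmorphM /= !conjCK; ring.
  by rewrite ltr_wpDr ?mul_conjC_ge0 // addr_gt0 // sq_lt.
have terms : {in [seq om * (y - r) / (x - r) | r <- rs], forall u, 0 < u + u^*}.
  move=> _ /mapP[r rrs ->].
  have xr : x - r != 0 by rewrite subr_eq0; apply: contraNneq xrs => ->.
  have N_gt0 : 0 < (x - r) * (x - r)^* by rewrite mul_conjC_gt0.
  have -> : om * (y - r) / (x - r) = om * (y - r) * (x - r)^* / ((x - r) * (x - r)^*).
    have : (x - r)^* != 0 by rewrite conjC_eq0.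
    by move: ((x - r)^*) (om) => c om' c_neq0; field; rewrite ?xr ?c_neq0.
  rewrite rmorphM fmorphV /= [in X in _ + _ / X]rmorphM /= conjCK [(x - r)^* * _]mulrC.
  rewrite -mulrDl divr_gt0 // (laguerre_identity _ _ _ rhoR).
  apply: ltr_wpDr.
    apply: mulr_ge0; last exact: mul_conjC_ge0.
    by rewrite sqr subr_ge0 ler_pXn2r ?nnegrE ?rs_ge ?normr_ge0 // ltW.
  apply: ltr_wpDl; first by rewrite mulr_ge0 ?mul_conjC_ge0 // ltW // sq_lt.
  by rewrite mulr_gt0 // sq_lt.
have := Re_sum_gt0 om_gt0 terms (k := k).
rewrite size_map => /(_ szrs k_gt0).
(* As [(y - r) / (x - r) = 1 + (y - x) / (x - r)], the roots and the padding add up to [om] times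
   the factor to be shown nonzero. *)
have -> : \sum_(u <- [seq om * (y - r) / (x - r) | r <- rs]) u + om *+ (k - size rs) =
    om * (k%:R + (y - x) * S).
  have sumE : \sum_(u <- [seq om * (y - r) / (x - r) | r <- rs]) u =
     om *+ size rs + om * ((y - x) * S).
    rewrite big_map /S {szrs rsE rs_ge P_neq0 terms S P}.
    elim: rs xrs => [_|r s IH]; first by rewrite !big_nil mulr0n; ring.
    rewrite in_cons negb_or => /andP[xr /IH {}IH].
    rewrite !big_cons IH /= mulrS.
    have : x - r != 0 by rewrite subr_eq0.
    by move=> h; field.
  rewrite sumE addrAC -mulrnDr subnKC // -mulr_natr; ring.
by apply: contraTneq => ->; rewrite mulr0 rmorph0 addr0 ltxx.
Qed.

(** For [c != 0], [a / c] is the product of the two roots, and neither lies in the open unit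
    disc. *)
Lemma quadratic_root_product (a b c : K) :
  (forall s, `|s| < 1 -> a + b * s + c * s ^+ 2 != 0) -> `|c| <= `|a|.
Proof.
move=> h.
pose p : {poly K} := Poly [:: a; b; c].
have pE s : p.[s] = a + b * s + c * s ^+ 2 by rewrite horner_Poly /=; ring.
have [c0|c_neq0] := eqVneq c 0; first by rewrite c0 normr0.
have a_neq0 : a != 0 by have := h 0; rewrite normr0 ltr01 => /(_ isT); rewrite expr0n !mulr0 !addr0.
have szp : size p = 3%N by rewrite (@PolyK _ 0).
have [rs rsE] := closed_field_poly_normal p.
have lc : lead_coef p = c by rewrite lead_coefE szp /p (@PolyK _ 0).
have szr : size rs = 2%N.
  by have := szp; rewrite rsE size_scale ?lc // size_prod_XsubC => -[].
case: rs szr rsE => [//|r1 [//|r2 []]] // _ rsE.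
have rsh s : p.[s] = c * ((s - r1) * (s - r2)).
  by rewrite rsE lc hornerZ big_cons big_cons big_nil mulr1 hornerM !hornerXsubC.
have aE : a = c * (r1 * r2).
  by have := rsh 0; rewrite pE expr0n /= !mulr0 !addr0 => ->; ring.
have rge r : p.[r] = 0 -> 1 <= `|r|.
  move=> pr; rewrite real_leNgt ?normr_real ?real1 //.
  by apply/negP => /h; rewrite -pE pr eqxx.
rewrite aE !normrM ler_peMr // -[1]mulr1 ler_pM // rge // rsh; ring.
Qed.

(** On the line [w = rho * z] the form is a quadratic in [z] with constant term [a] and leading
    coefficient [d * rho], so [|d| * rho <= |a|]; with [a != 0] and [rho > 1] this excludes
    [a = d]. *)
Lemma asano_contraction (rho a b c d : K) : 1 < rho ->
  (forall z w, `|z| < 1 -> `|w| < rho -> a + b * z + c * w + d * (z * w) != 0) ->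
  a - d != 0.
Proof.
move=> rho_gt1 h; have rho_gt0 : 0 < rho by apply: lt_trans rho_gt1.
have hq : `|d * rho| <= `|a|.
  apply: (@quadratic_root_product a (b + c * rho)) => s s1.
  have := h s (rho * s) s1; rewrite normrM gtr0_norm // gtr_pMr // => /(_ s1).
  by congr (_ != 0); ring.
have a_neq0 : a != 0.
  by have := h 0 0; rewrite !mulr0 !addr0 normr0; apply.
apply/eqP => /subr0_eq ad; move: hq; rewrite -ad normrM (gtr0_norm rho_gt0).
by rewrite lt_geF // ltr_pMr ?normr_gt0.
Qed.

(** A two-variable polynomial is encoded as a list of pairs, read as a sum of products
    [p(z) q(w)]. *)
Definition tensor_eval (Q : seq ({poly K} * {poly K})) z w : K :=
  \sum_(t <- Q) t.1.[z] * t.2.[w].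

(** Up to the factor [k!], the apolar form of [p] with the reversal of [q] in degree [k]; this is
    why both coefficients carry the same index. *)
Definition grace_pairing (k : nat) p q : K :=
  \sum_(m < k.+1) (-1) ^+ m * p`_m * q`_m / 'C(k, m)%:R.

(** The polar derivative with pole 0: the expression in [laguerre] is [polar k p + y p'] at [x],
    affine in [y]. *)
Definition polar (k : nat) p : {poly K} := k%:R *: p - 'X * p^`().

Lemma coef_polar k p m : (polar k p)`_m = (k%:R - m%:R) * p`_m.
Proof.
rewrite coefB coefZ coefXM; case: m => [|m] /=; first by rewrite !subr0.
by rewrite coef_deriv -mulr_natr; ring.
Qed.

Lemma size_polar k p : (size p <= k.+1)%N -> (size (polar k p) <= k)%N.
Proof.
move=> szp; apply/leq_sizeP => m km; rewrite coef_polar.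
move: km; rewrite leq_eqVlt => /orP[/eqP<-|km]; first by rewrite subrr mul0r.
by rewrite nth_default ?mulr0 // (leq_trans szp).
Qed.

Lemma size_deriv_le k p : (size p <= k.+1)%N -> (size p^`() <= k)%N.
Proof. by move=> szp; apply: leq_trans (size_poly _ _) _; rewrite -ltnS; case: size szp. Qed.

Lemma horner_polar k p x : (polar k p).[x] = k%:R * p.[x] - x * p^`().[x].
Proof. by rewrite /polar !hornerE. Qed.

Lemma binomial_exchange (s d c1 c2 n u v : K) : d * c1 = n * c2 -> c1 != 0 -> c2 != 0 ->
  s * (d * u) * (d * v) / c2 = n * d * (s * u * v / c1).
Proof.
move=> h c1n c2n; have -> : n = d * c1 / c2 by rewrite h; field.
by field; rewrite c1n c2n.
Qed.

(** The two pairings on the right contribute [k (k - m)] and, after an index shift that flips the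
    sign, [k m] times the term of index [m] on the left; together [k^2]. *)
Lemma grace_pairingS k p q : (0 < k)%N ->
  k%:R ^+ 2 * grace_pairing k p q =
  grace_pairing k.-1 (polar k p) (polar k q) - grace_pairing k.-1 p^`() q^`().
Proof.
case: k => // k _ /=; rewrite /grace_pairing.
have bin_neq0 n m : (m <= n)%N -> 'C(n, m)%:R != 0 :> K.
  by move=> mn; rewrite pnatr_eq0 -lt0n bin_gt0.
pose g m : K := (-1) ^+ m * p`_m * q`_m / 'C(k.+1, m)%:R.
have E1 : \sum_(m < k.+1) (-1) ^+ m * (polar k.+1 p)`_m * (polar k.+1 q)`_m / 'C(k, m)%:R
   = \sum_(m < k.+2) k.+1%:R * (k.+1%:R - m%:R) * g m.
  rewrite [RHS]big_ord_recr /= subrr mulr0 mul0r addr0; apply: eq_bigr => m _.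
  have mk : (m <= k)%N by rewrite -ltnS.
  rewrite !coef_polar /g.
  have h : (k.+1%:R - m%:R) * 'C(k.+1, m)%:R = k.+1%:R * 'C(k, m)%:R :> K.
    by rewrite -natrB ?leqW // -!natrM mul_bin_down.
  by rewrite (binomial_exchange _ _ _ h) ?bin_neq0 // leqW.
have E2 : \sum_(m < k.+1) (-1) ^+ m * p^`()`_m * q^`()`_m / 'C(k, m)%:R
   = - \sum_(m < k.+2) k.+1%:R * m%:R * g m.
  rewrite [in RHS]big_ord_recl /= mulr0 mul0r add0r -sumrN; apply: eq_bigr => m _.
  have mk : (m <= k)%N by rewrite -ltnS.
  rewrite !coef_deriv /g /= /bump /= add1n exprS.
  have h : m.+1%:R * 'C(k.+1, m.+1)%:R = k.+1%:R * 'C(k, m)%:R :> K.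
    by rewrite -!natrM -mul_bin_diag.
  rewrite -(mulr_natl p`_m.+1) -(mulr_natl q`_m.+1) (binomial_exchange _ _ _ h) ?bin_neq0 //.
  by rewrite mulN1r !mulNr mulrN opprK.
rewrite E1 E2 opprK -big_split /= mulr_sumr; apply: eq_bigr => m _.
by rewrite -/(g m); move: (g m) (m%:R) (k.+1%:R) => x y z; ring.
Qed.

(** The difference [a - d] of [asano_contraction], where [a] comes from the polar derivatives and
    [d] from the derivatives; the minus sign sits on the first factor. *)
Definition contract (k : nat) (Q : seq ({poly K} * {poly K})) :=
  [seq (polar k t.1, polar k t.2) | t <- Q] ++ [seq (- t.1^`(), t.2^`()) | t <- Q].

Lemma grace_pairingZl k (a : K) p q : grace_pairing k (a *: p) q = a * grace_pairing k p q.
Proof. by rewrite mulr_sumr; apply: eq_bigr => m _; rewrite coefZ mulrCA -!mulrA. Qed.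

Lemma grace_pairingNl k p q : grace_pairing k (- p) q = - grace_pairing k p q.
Proof. by rewrite -scaleN1r grace_pairingZl mulN1r. Qed.

(* Replacing [p] by the polarization [p + (x1 - x) p' / k] in each variable
   keeps the form nonzero by Laguerre; [contract] is then the Asano contraction
   of the two new variables. *)
Lemma contract_neq0 k (Q : seq ({poly K} * {poly K})) (rho : K) : (0 < k)%N -> 1 < rho ->
  {in Q, forall t : {poly K} * {poly K}, (size t.1 <= k.+1)%N /\ (size t.2 <= k.+1)%N} ->
  (forall z w, `|z| < 1 -> `|w| < rho -> tensor_eval Q z w != 0) ->
  forall z w, `|z| < 1 -> `|w| < rho -> tensor_eval (contract k Q) z w != 0.
Proof.
move=> k_gt0 rho_gt1 szQ hQ z w z1 wrho.
rewrite /tensor_eval /contract big_cat !big_map /=.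
have -> : \sum_(t <- Q) (polar k t.1).[z] * (polar k t.2).[w] +
          \sum_(t <- Q) (- t.1^`()).[z] * t.2^`().[w] =
   \sum_(t <- Q) (polar k t.1).[z] * (polar k t.2).[w] - \sum_(t <- Q) t.1^`().[z] * t.2^`().[w].
  by congr (_ + _); rewrite -sumrN; apply: eq_bigr => t _; rewrite hornerN mulNr.
apply: (@asano_contraction rho _ (\sum_(t <- Q) t.1^`().[z] * (polar k t.2).[w])
  (\sum_(t <- Q) (polar k t.1).[z] * t.2^`().[w])) => // x y x1 yrho.
(* Laguerre in [z] on the unit disc, with the second variable frozen at [v]. *)
have step1 v : `|v| < rho ->
   \sum_(t <- Q) ((polar k t.1).[z] + x * t.1^`().[z]) * t.2.[v] != 0.
  move=> vrho; pose p : {poly K} := \sum_(t <- Q) t.2.[v] *: t.1.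
  have pE u : p.[u] = tensor_eval Q u v.
    by rewrite horner_sum; apply: eq_bigr => t _; rewrite hornerZ mulrC.
  have szp : (size p <= k.+1)%N.
    rewrite /p big_seq; apply: (leq_trans (size_sum _ _ _)).
    apply/bigmax_leqP_seq => t tQ _; apply: leq_trans (size_scale_leq _ _) _.
    by case: (szQ t tQ).
  have := @laguerre p k 1 z x k_gt0 szp _ z1 x1.
  have -> : k%:R * p.[z] + (x - z) * p^`().[z] =
    \sum_(t <- Q) ((polar k t.1).[z] + x * t.1^`().[z]) * t.2.[v].
    rewrite /p raddf_sum /= !horner_sum !mulr_sumr -big_split /=.
    by apply: eq_bigr => t _; rewrite derivZ !hornerZ horner_polar; ring.
  by apply => u u1; rewrite pE hQ.
(* Laguerre in [w] on the disc of radius [rho], with [z] and the new variable [x] frozen. *)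
pose q : {poly K} := \sum_(t <- Q) ((polar k t.1).[z] + x * t.1^`().[z]) *: t.2.
have qE u : q.[u] = \sum_(t <- Q) ((polar k t.1).[z] + x * t.1^`().[z]) * t.2.[u].
  by rewrite horner_sum; apply: eq_bigr => t _; rewrite hornerZ.
have szq : (size q <= k.+1)%N.
  rewrite /q big_seq; apply: (leq_trans (size_sum _ _ _)).
  apply/bigmax_leqP_seq => t tQ _; apply: leq_trans (size_scale_leq _ _) _.
  by case: (szQ t tQ).
have := @laguerre q k rho w y k_gt0 szq _ wrho yrho.
have -> : k%:R * q.[w] + (y - w) * q^`().[w] =
    \sum_(t <- Q) (polar k t.1).[z] * (polar k t.2).[w] +
    (\sum_(t <- Q) t.1^`().[z] * (polar k t.2).[w]) * x +
    (\sum_(t <- Q) (polar k t.1).[z] * t.2^`().[w]) * y +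
    (\sum_(t <- Q) t.1^`().[z] * t.2^`().[w]) * (x * y).
  rewrite /q raddf_sum /= !horner_sum !mulr_sumr !mulr_suml -!big_split /=.
  by apply: eq_bigr => t _; rewrite derivZ !hornerZ !horner_polar; ring.
by apply => u urho; rewrite qE step1.
Qed.

(** Induction on [k]: [contract] lowers the degree by one with the same [rho] and multiplies the sum
    of pairings by a nonzero constant. In degree 0 the pairing is evaluation at [(0, 0)]. *)
Lemma disc_grace k (Q : seq ({poly K} * {poly K})) (rho : K) : 1 < rho ->
  {in Q, forall t : {poly K} * {poly K}, (size t.1 <= k.+1)%N /\ (size t.2 <= k.+1)%N} ->
  (forall z w, `|z| < 1 -> `|w| < rho -> tensor_eval Q z w != 0) ->
  \sum_(t <- Q) grace_pairing k t.1 t.2 != 0.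
Proof.
move=> rho_gt1; elim: k Q => [|k IH] Q szQ hQ.
  have := hQ 0 0; rewrite normr0 ltr01 (lt_trans ltr01 rho_gt1) => /(_ isT isT).
  congr (_ != 0); apply: eq_bigr => t _.
  by rewrite /grace_pairing big_ord_recl big_ord0 !horner_coef0 /= mul1r addr0 bin0 divr1.
have k_gt0 : (0 < k.+1)%N by [].
have := IH (contract k.+1 Q); rewrite /contract big_cat !big_map /= -big_split /=.
have -> : \sum_(t <- Q) (grace_pairing k (polar k.+1 t.1) (polar k.+1 t.2) +
    grace_pairing k (- t.1^`()) t.2^`()) =
  k.+1%:R ^+ 2 * \sum_(t <- Q) grace_pairing k.+1 t.1 t.2.
  by rewrite mulr_sumr; apply: eq_bigr => t _; rewrite grace_pairingS //= grace_pairingNl.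
move=> h; suff: k.+1%:R ^+ 2 * \sum_(t <- Q) grace_pairing k.+1 t.1 t.2 != 0.
  by rewrite mulf_eq0 negb_or => /andP[].
apply: h.
  move=> t; rewrite mem_cat => /orP[]/mapP[u /szQ [s1 s2] ->] /=.
    by rewrite !size_polar.
  by rewrite size_polyN !size_deriv_le.
exact: contract_neq0.
Qed.

End DiscGrace.

(** * Limits and compactness *)

Section Limits.
Variable K : numFieldType.
Implicit Types (u v : nat -> K) (l c : K).

Definition tends_to u l :=
  forall e, 0 < e -> exists N, forall m, (N <= m)%N -> `|u m - l| < e.

Lemma tends_to_ext u v l : u =1 v -> tends_to u l -> tends_to v l.
Proof. by move=> uv ul e /ul[N h]; exists N => m /h; rewrite uv. Qed.

Lemma tends_to_cst c : tends_to (fun=> c) c.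
Proof. by move=> e e_gt0; exists 0%N => m _; rewrite subrr normr0. Qed.

Lemma tends_toD u v l c :
  tends_to u l -> tends_to v c -> tends_to (fun m => u m + v m) (l + c).
Proof.
move=> ul vc e e_gt0; have e2 : 0 < e / 2 by rewrite divr_gt0.
have [[N1 h1] [N2 h2]] := (ul _ e2, vc _ e2).
exists (maxn N1 N2) => m; rewrite geq_max => /andP[/h1 {}h1 /h2 {}h2].
rewrite opprD addrACA (le_lt_trans (ler_normD _ _)) //.
by rewrite [X in _ < X](_ : e = e / 2 + e / 2); [exact: ltrD | field].
Qed.

Lemma tends_toM u v l c :
  tends_to u l -> tends_to v c -> tends_to (fun m => u m * v m) (l * c).
Proof.
(* The summand [e] makes [d = e / b] less than 1, and the summand 1 then gives
   [d * (d + |l| + |c|) < d * b = e]. *)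
move=> ul vc e e_gt0; set b := 1 + `|l| + `|c| + e.
have b_gt0 : 0 < b by rewrite ltr_wpDl // !addr_ge0.
have d_gt0 : 0 < e / b by rewrite divr_gt0.
have [[N1 h1] [N2 h2]] := (ul _ d_gt0, vc _ d_gt0).
exists (maxn N1 N2) => m; rewrite geq_max => /andP[/h1 {}h1 /h2 {}h2].
set d := e / b in h1 h2 d_gt0.
have -> : u m * v m - l * c = (u m - l) * (v m - c) + l * (v m - c) + (u m - l) * c by ring.
have d_lt1 : d < 1.
  by rewrite /d ltr_pdivrMr // mul1r /b ltrDr ltr_wpDr // ltr_wpDr // ltr01.
have le_t : `|(u m - l) * (v m - c) + l * (v m - c) + (u m - l) * c| <=
   d * d + `|l| * d + d * `|c|.
  apply: le_trans (ler_normD _ _) _; apply: lerD; last first.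
    by rewrite normrM ler_wpM2r // ltW.
  apply: le_trans (ler_normD _ _) _; rewrite !normrM; apply: lerD.
    by apply: ler_pM => //; apply: ltW.
  by rewrite ler_wpM2l // ltW.
apply: le_lt_trans le_t _.
have -> : e = d * b by rewrite /d; field; apply: lt0r_neq0.
have -> : d * d + `|l| * d + d * `|c| = d * (d + `|l| + `|c|) by ring.
by rewrite ltr_pM2l // /b ltr_pwDr // !lerD // ltW.
Qed.

Lemma tends_to_sum (I : Type) (s : seq I) (F : I -> nat -> K) (L : I -> K) :
  (forall i, tends_to (F i) (L i)) ->
  tends_to (fun m => \sum_(i <- s) F i m) (\sum_(i <- s) L i).
Proof.
move=> FL; elim: s => [|i s IH].
  by rewrite big_nil; apply: tends_to_ext (tends_to_cst 0) => m; rewrite big_nil.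
rewrite big_cons; apply: tends_to_ext (tends_toD (FL i) IH) => m.
by rewrite big_cons.
Qed.

Lemma tends_to_prod (I : Type) (s : seq I) (F : I -> nat -> K) (L : I -> K) :
  (forall i, tends_to (F i) (L i)) ->
  tends_to (fun m => \prod_(i <- s) F i m) (\prod_(i <- s) L i).
Proof.
move=> FL; elim: s => [|i s IH].
  by rewrite big_nil; apply: tends_to_ext (tends_to_cst 1) => m; rewrite big_nil.
rewrite big_cons; apply: tends_to_ext (tends_toM (FL i) IH) => m.
by rewrite big_cons.
Qed.

Lemma tends_to_exp u l k : tends_to u l -> tends_to (fun m => u m ^+ k) (l ^+ k).
Proof.
move=> ul; elim: k => [|k IH]; first exact: tends_to_cst.
by rewrite exprS; apply: tends_to_ext (tends_toM ul IH) => m; rewrite exprS.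
Qed.

Lemma tends_to_meval (n : nat) (G : {mpoly K[n]}) (v : nat -> 'I_n -> K) (l : 'I_n -> K) :
  (forall i, tends_to (v^~ i) (l i)) -> tends_to (fun m => G.@[v m]) G.@[l].
Proof.
move=> vl; rewrite mevalE.
apply: (tends_to_ext (u := fun m => \sum_(a <- msupp G) G@_a * \prod_i v m i ^+ a i)).
  by move=> m; rewrite mevalE.
apply: tends_to_sum => a; apply: tends_toM; first exact: tends_to_cst.
by apply: tends_to_prod => i; apply: tends_to_exp.
Qed.

(** Extractions are encoded by [m <= phi m], a condition that suffices for limits and is stable
    under composition. *)
Lemma tends_to_subseq u l (phi : nat -> nat) :
  (forall m, (m <= phi m)%N) -> tends_to u l -> tends_to (u \o phi) l.
Proof.
move=> hphi ul e /ul[N h]; exists N => m Nm; apply: h.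
exact: leq_trans (hphi m).
Qed.

Lemma tends_to_le u w l c : c \is Num.real -> (forall m, `|u m| <= w m) ->
  tends_to u l -> tends_to w c -> `|l| <= c.
Proof.
move=> cR uw ul wc; rewrite real_leNgt ?normr_real //; apply/negP => cl.
have e_gt0 : 0 < (`|l| - c) / 2 by rewrite divr_gt0 // subr_gt0.
have [[N1 h1] [N2 h2]] := (ul _ e_gt0, wc _ e_gt0).
set m := maxn N1 N2.
have {}h1 := h1 m (leq_maxl _ _); have {}h2 := h2 m (leq_maxr _ _).
have : `|l| < `|l|.
  apply: le_lt_trans (_ : `|l - u m| + `|u m| < _).
    by rewrite -{1}[l](subrK (u m)) ler_normD.
  have -> : `|l| = (`|l| - c) / 2 + ((`|l| - c) / 2 + c) by field.
  rewrite ltr_leD //; first by rewrite distrC.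
  apply: le_trans (uw m) _; rewrite -[w m](subrK c) lerD2r.
  apply: le_trans (ltW h2); apply: real_ler_norm.
  by rewrite rpredB // ger0_real // (le_trans (normr_ge0 _) (uw m)).
by rewrite ltxx.
Qed.

End Limits.

(** * Bolzano-Weierstrass and compactness of the closed polydisc *)

Section Compactness.
Variable R : realType.
Local Notation C := R[i].
Local Notation Re := (@complex.Re R).
Local Notation Im := (@complex.Im R).
Local Open Scope complex_scope.

Lemma tends_to_inv_succ : tends_to (fun m => m.+1%:R^-1 : C) 0.
Proof.
move=> e e_gt0.
have eE : e = (Re e)%:C by rewrite RRe_real // gtr0_real.
have re_gt0 : 0 < Re e by rewrite -ltcR -eE.
exists (Num.bound (Re e)^-1) => m Nm.
rewrite subr0 ger0_norm ?invr_ge0 ?ler0n // invf_plt ?posrE ?ltr0Sn //.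
have -> : e^-1 = ((Re e)^-1)%:C by rewrite {1}eE fmorphV.
have -> : m.+1%:R = (m.+1%:R : R)%:C by rewrite rmorph_nat.
rewrite ltcR; apply: lt_trans (archi_boundP _) _; first by rewrite invr_ge0 ltW.
by rewrite ltr_nat ltnS.
Qed.

Lemma tends_to_near_seq (u : nat -> C) (l : C) :
  (forall m, `|u m - l| < m.+1%:R^-1) -> tends_to u l.
Proof.
move=> h e /tends_to_inv_succ[N hN]; exists N => m /hN.
rewrite subr0 ger0_norm ?invr_ge0 ?ler0n //; exact: lt_trans.
Qed.

(** The limit is the limit superior of [u], obtained as the supremum of the numbers that [u] reaches
    or exceeds at arbitrarily late indices. *)
Lemma bolzano_weierstrass_real (u : nat -> R) (M : R) : (forall m, `|u m| <= M) ->
  exists (phi : nat -> nat) (l : R),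
    (forall m, (m <= phi m)%N) /\ forall m, `|u (phi m) - l| < m.+1%:R^-1.
Proof.
move=> uM; pose E := [set x : R | forall N, exists2 m, (N <= m)%N & x <= u m]%classic.
have supE : has_sup E.
  split; first by exists (- M) => N; exists N => //; have := uM N; rewrite ler_norml => /andP[].
  exists M => x /(_ 0%N)[m _ /le_trans]; apply; exact: le_trans (ler_norm _) (uM m).
pose l := sup E.
have near (m : nat) : exists p, (m <= p)%N /\ `|u p - l| < m.+1%:R^-1.
  have e_gt0 : 0 < m.+1%:R^-1 :> R by rewrite invr_gt0 ltr0Sn.
  have [x Ex lx] := sup_adherent e_gt0 supE.
  have nE : ~ E (l + m.+1%:R^-1 / 2).
    move=> /(sup_upper_bound supE); rewrite -/l gerDl leNgt divr_gt0 //.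
  have [N hN] : exists N, forall p, (N <= p)%N -> u p < l + m.+1%:R^-1 / 2.
    apply: boolp.contrapT => h; apply: nE => N; apply: boolp.contrapT => h2; apply: h.
    exists N => p Np; rewrite ltNge; apply/negP => h3; apply: h2; by exists p.
  have [p] := Ex (maxn m N); rewrite geq_max => /andP[mp Np] xp.
  exists p; split => //; rewrite ltr_norml; apply/andP; split.
    by rewrite ltrBrDr addrC; apply: lt_le_trans xp.
  rewrite ltrBlDr addrC; apply: lt_trans (hN p Np) _.
  by rewrite ltrD2l ltr_pdivrMr // ltr_pMr // ltr1n.
by have [phi hphi] := boolp.choice near; exists phi, l; split => m; case: (hphi m).
Qed.

Lemma bolzano_weierstrass_family (T : eqType) (s : seq T) (u : T -> nat -> R) (M : R) :
  (forall t m, `|u t m| <= M) ->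
  exists phi : nat -> nat, (forall m, (m <= phi m)%N) /\
    {in s, forall t, exists l : R, tends_to (fun m => (u t (phi m))%:C) l%:C}.
Proof.
move=> uM; elim: s => [|t s [phi [hphi IH]]]; first by exists id.
have [psi [l [hpsi hl]]] := bolzano_weierstrass_real (fun m => uM t (phi m)).
exists (phi \o psi); split => [m|t']; first exact: leq_trans (hphi _).
rewrite in_cons => /predU1P[->|/IH[l' hl']].
  exists l; apply: tends_to_near_seq => m /=.
  rewrite -rmorphB normc_def /= expr0n addr0 sqrtr_sqr.
  by have -> : m.+1%:R^-1 = (m.+1%:R^-1 : R)%:C; rewrite ?ltcR // fmorphV rmorph_nat.
by exists l'; apply: (tends_to_subseq hpsi hl').
Qed.

Lemma bolzano_weierstrass (n : nat) (v : nat -> 'I_n -> C) (M : R) :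
  (forall m i, `|v m i| <= M%:C) ->
  exists (phi : nat -> nat) (l : 'I_n -> C), (forall m, (m <= phi m)%N) /\
    forall i, tends_to (fun m => v (phi m) i) (l i).
Proof.
move=> vM; pose u (t : 'I_n * bool) m := if t.2 then Im (v m t.1) else Re (v m t.1).
have uM t m : `|u t m| <= M.
  rewrite -lecR; apply: le_trans (vM m t.1); rewrite /u; case: t.2; last exact: normc_ge_Re.
  rewrite -[Im _]opprK -ReiNIm normrN; apply: le_trans (normc_ge_Re _) _.
  by rewrite normrM complexiE normCi mulr1.
have [phi [hphi hl]] := bolzano_weierstrass_family (enum [the finType of ('I_n * bool)%type]) uM.
have hl2 i : exists l : C, tends_to (fun m => v (phi m) i) l.
  have [a ha] := hl (i, false) (mem_enum _ _).
  have [b hb] := hl (i, true) (mem_enum _ _).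
  exists (a%:C + 'i * b%:C).
  apply: tends_to_ext (tends_toD ha (tends_toM (tends_to_cst 'i) hb)) => m.
  by rewrite /u /= -complexE.
have [l hl3] := fin_all_exists hl2.
by exists phi, l.
Qed.

(** Otherwise there are zeros in the polydiscs of radius [1 + 1/(m+1)], and a limit point of them is
    a zero in the closed unit polydisc. *)
Lemma closed_polydisc_open_nbhd (n : nat) (G : {mpoly C[n]}) :
  (forall v, (forall i, `|v i| <= 1) -> G.@[v] != 0) ->
  exists2 rho : C, 1 < rho & forall v, (forall i, `|v i| < rho) -> G.@[v] != 0.
Proof.
move=> hG; apply: boolp.contrapT => hN.
have bad (m : nat) : exists v : 'I_n -> C, (forall i, `|v i| < 1 + m.+1%:R^-1) /\ G.@[v] = 0.
  apply: boolp.contrapT => hm; apply: hN; exists (1 + m.+1%:R^-1).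
    by rewrite ltrDl invr_gt0 ltr0Sn.
  by move=> v hv; apply/eqP => Gv; apply: hm; exists v.
have [v hv] := boolp.choice bad.
have v2 m i : `|v m i| <= (2 : R)%:C.
  have [/(_ i)/ltW vi _] := hv m; apply: le_trans vi _.
  have -> : (2 : R)%:C = 1 + 1 :> C by rewrite rmorph_nat.
  by rewrite lerD2l invf_le1 ?ltr0Sn // ler1n.
have [phi [l [hphi hl]]] := bolzano_weierstrass v2.
have l1 i : `|l i| <= 1.
  apply: (tends_to_le (u := fun m => v (phi m) i) (w := fun m => 1 + (phi m).+1%:R^-1)) => //.
    by move=> m; have [/(_ i)/ltW] := hv (phi m).
  rewrite -[X in tends_to _ X]addr0; apply: tends_toD; first exact: tends_to_cst.
  exact: (tends_to_subseq hphi tends_to_inv_succ).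
have : tends_to (fun m => G.@[v (phi m)]) G.@[l] by apply: tends_to_meval.
move=> /(tends_to_le (w := fun=> 0) (c := 0)) h.
have : `|G.@[l]| <= 0.
  apply: h => //; last exact: tends_to_cst.
  by move=> m; have [_ ->] := hv (phi m); rewrite normr0.
by rewrite normr_le0 (negPf (hG l l1)).
Qed.

End Compactness.

(** * Hurwitz's theorem *)

Section Hurwitz.
Variable K : numClosedFieldType.

(** Each root [r] has [|r| >= delta], hence [|s - r| <= (1 + |s| / delta) * |r|]. The factor depends
    on [p] only through [d] and [delta], so the bound survives limits. *)
Lemma zero_free_growth (p : {poly K}) (d : nat) (delta s : K) : (size p <= d.+1)%N ->
  0 < delta -> (forall z, `|z| < delta -> p.[z] != 0) ->
  `|p.[s]| <= (1 + `|s| / delta) ^+ d * `|p.[0]|.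
Proof.
move=> szp delta_gt0 p_neq0.
have [rs rsE] := closed_field_poly_normal p.
have lc_neq0 : lead_coef p != 0.
  by apply: contraNneq (p_neq0 0 _) => [l0|]; rewrite ?normr0 // rsE l0 scale0r horner0.
have rs_ge r : r \in rs -> delta <= `|r|.
  move=> rrs; rewrite real_leNgt ?normr_real ?gtr0_real //.
  apply/negP => /p_neq0; rewrite rsE hornerZ horner_prod (big_rem r) //=.
  by rewrite hornerXsubC subrr mul0r mulr0 eqxx.
have szrs : (size rs <= d)%N.
  by move: szp; rewrite rsE size_scale // size_prod_XsubC ltnS.
set b := 1 + _; have b_ge1 : 1 <= b by rewrite lerDl divr_ge0 // ltW.
rewrite rsE !hornerZ !normrM mulrCA ler_wpM2l // {rsE szp}.
apply: (@le_trans _ _ (b ^+ size rs * `|(\prod_(z <- rs) ('X - z%:P)).[0]|)); last first.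
  by rewrite ler_wpM2r // ler_weXn2l.
elim: rs rs_ge {szrs} => [|r rs IH] rs_ge.
  by rewrite !big_nil expr0 mul1r !hornerE.
rewrite !big_cons /= exprS !hornerM !normrM mulrACA.
apply: ler_pM => //; last by apply: IH => z zrs; apply: rs_ge; rewrite in_cons zrs orbT.
rewrite !hornerXsubC sub0r normrN.
apply: le_trans (ler_normB _ _) _; rewrite /b mulrDl mul1r addrC lerD2l mulrAC -mulrA ler_peMr //.
by rewrite ler_pdivlMr // mul1r rs_ge // mem_head.
Qed.

(** The size bound depends on [G] only, so one exponent serves a whole sequence of lines. *)
Lemma meval_line (n : nat) (G : {mpoly K[n]}) (a c : 'I_n -> K) :
  exists2 p : {poly K}, (size p <= (msize G).+1)%N &
    forall s, p.[s] = G.@[fun i => a i + s * c i].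
Proof.
pose F (m : 'X_{1..n}) : {poly K} := \prod_i ((a i)%:P + c i *: 'X) ^+ m i.
exists (\sum_(m <- msupp G) G@_m *: F m).
  rewrite big_seq; apply: leq_trans (size_sum _ _ _) _.
  apply/bigmax_leqP_seq => m mG _; apply: leq_trans (size_scale_leq _ _) _.
  apply: leq_trans (_ : (mdeg m).+1 <= _)%N; last by rewrite ltnS ltnW // msize_mdeg_lt.
  rewrite mdegE /F; apply: (big_rec2 (fun (q : {poly K}) d => size q <= d.+1)%N).
    by rewrite size_poly1.
  move=> i q d _ szq; apply: leq_trans (size_polyMleq _ _) _.
  set e := (_ + _) ^+ _; have : (size e <= (m i).+1)%N.
    apply: leq_trans (size_poly_exp_leq _ _) _; rewrite ltnS.
    rewrite -[leqRHS]mul1n leq_mul2r; apply/orP; right.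
    rewrite -subn1 leq_subLR (leq_trans (size_polyD _ _)) // geq_max.
    by rewrite (leq_trans (size_polyC_leq1 _)) // (leq_trans (size_scale_leq _ _)) // size_polyX.
  by move: (size e) (size q) szq => x y; lia.
move=> s; rewrite mevalE horner_sum; apply: eq_bigr => m _.
rewrite hornerZ horner_prod; congr (_ * _); apply: eq_bigr => i _.
by rewrite horner_exp hornerD hornerC hornerZ hornerX [c i * s]mulrC.
Qed.

(** By [zero_free_growth], the value at [x m + s c] is bounded by a constant independent of [m]
    times [|G(x m)|], which tends to [|G(a)| = 0]. *)
Lemma hurwitz_line (n : nat) (G : {mpoly K[n]}) (x : nat -> 'I_n -> K) (a c : 'I_n -> K)
    (delta : K) : 0 < delta -> (forall i, tends_to (x^~ i) (a i)) ->
  (forall m s, `|s| < delta -> G.@[fun i => x m i + s * c i] != 0) ->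
  G.@[a] = 0 -> forall s, G.@[fun i => a i + s * c i] = 0.
Proof.
move=> delta_gt0 xa G_neq0 Ga s; set d := msize G.
have bound m : `|G.@[fun i => x m i + s * c i]| <=
    `|(1 + `|s| / delta) ^+ d * G.@[x m]|.
  have [p szp pE] := meval_line G (x m) c.
  have := @zero_free_growth p d delta s szp delta_gt0 _.
  rewrite !pE normrM (ger0_norm (exprn_ge0 _ _)); last first.
    by rewrite addr_ge0 // divr_ge0 // ltW.
  have -> : G.@[fun i => x m i + 0 * c i] = G.@[x m].
    by apply: meval_eq => i; rewrite mul0r addr0.
  by apply => z zd; rewrite pE G_neq0.
apply/eqP; rewrite -normr_le0.
apply: (tends_to_le _ bound) => //.
  apply: tends_to_meval => i; apply: tends_toD => //; exact: tends_to_cst.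
have := tends_toM (tends_to_cst ((1 + `|s| / delta) ^+ d)) (@tends_to_meval K n G _ _ xa).
rewrite Ga mulr0 => h e /h[N hN]; exists N => m /hN.
by rewrite !subr0 normr_id.
Qed.

Lemma small_multiples (n : nat) (c e : 'I_n -> K) : (forall i, 0 < e i) ->
  exists2 delta : K, 0 < delta & forall i s, `|s| < delta -> `|s * c i| < e i.
Proof.
(* [S] exceeds every ratio [|c i| / e i], so [delta = 1 / S] works for all [i] at once. *)
move=> e_gt0; pose S := 1 + \sum_i `|c i| / e i.
have sum_ge0 (P : pred 'I_n) : 0 <= \sum_(i | P i) `|c i| / e i.
  by apply: sumr_ge0 => i _; rewrite divr_ge0 // ltW.
have S_gt0 : 0 < S by rewrite ltr_wpDr.
exists S^-1 => [|i s sS]; first by rewrite invr_gt0.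
rewrite -[e i]mul1r -ltr_pdivrMr // normrM -mulrA.
apply: le_lt_trans (_ : S^-1 * (`|c i| / e i) < 1).
  by rewrite ler_wpM2r ?divr_ge0 // ltW.
rewrite mulrC ltr_pdivrMr // mul1r /S (bigD1 i) //= addrCA ltrDl.
by rewrite ltr_wpDr.
Qed.

End Hurwitz.

(** * Extending nonvanishing across coordinate hyperplanes *)

Section FillPunctures.
Variables (R : realType) (n : nat).
Local Notation C := R[i].
Variable G : {mpoly C[n]}.

(** Punctures are filled one at a time. A zero [v] with [v j = 0] is approached by points with
    nonzero coordinate [j]; Hurwitz on lines in the direction [w - v], which lies in the face, makes
    [G] vanish at [w], where it does not. *)
Lemma fill_punctures_open (js : seq 'I_n) :
  (forall j, j \in js -> exists2 v, v j = 0 & G.@[v] != 0) ->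
  (forall v, (forall i, `|v i| < 1) -> (forall j, j \in js -> v j != 0) -> G.@[v] != 0) ->
  forall v, (forall i, `|v i| < 1) -> G.@[v] != 0.
Proof.
elim: js => [|j js IH] G_face G_neq0; first by move=> v v1; apply: G_neq0.
apply: IH => [i ijs|v v1 v_neq0]; first by apply: G_face; rewrite in_cons ijs orbT.
have [vj0|vj_neq0] := eqVneq (v j) 0; last first.
  by apply: G_neq0 => // i; rewrite in_cons => /predU1P[->|/v_neq0].
have [w wj0 Gw] := G_face j (mem_head _ _).
apply: contraNneq Gw => Gv; apply/eqP.
(* A displacement of [v i] by less than [e i] stays in the unit disc and, when [v i != 0], does not
   reach 0. *)
pose e i : C := (1 - `|v i|) * (if v i == 0 then 1 else `|v i|).
have e_gt0 i : 0 < e i.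
  by rewrite mulr_gt0 ?subr_gt0 //; case: eqP => // /eqP; rewrite normr_gt0.
have [delta delta_gt0 hdelta] := small_multiples (fun i => w i - v i) e_gt0.
(* [m.+2] keeps coordinate [j] of modulus less than 1 already for [m = 0]. *)
pose x (m : nat) i : C := v i + (if i == j then m.+2%:R^-1 else 0).
have xv i : tends_to (x^~ i) (v i).
  rewrite -[X in tends_to _ X]addr0; apply: tends_toD; first exact: tends_to_cst.
  case: (i == j); last exact: tends_to_cst.
  exact: (tends_to_subseq (phi := succn) (fun m => leqnSn m) (@tends_to_inv_succ R)).
suff h : forall s, G.@[fun i => v i + s * (w i - v i)] = 0.
  by apply: etrans (h 1); apply: meval_eq => i; ring.
apply: (hurwitz_line delta_gt0 xv _ Gv).
move=> m s sd; apply: G_neq0 => i; rewrite /x.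
  case: eqP => [->|_].
    rewrite wj0 vj0 subr0 mulr0 addr0 add0r ger0_norm ?invr_ge0 ?ler0n //.
    by rewrite invf_lt1 ?ltr0Sn // ltr1n.
  rewrite addr0; apply: le_lt_trans (ler_normD _ _) _.
  rewrite -ltrBrDl; apply: lt_le_trans (hdelta i s sd) _.
  rewrite /e ler_piMr ?subr_ge0 //; first exact: ltW.
  by case: ifP => // _; exact: ltW.
rewrite in_cons => ij; case: (i =P j) => [->|/eqP nij].
  by rewrite wj0 vj0 subr0 mulr0 addr0 add0r invr_eq0 pnatr_eq0.
have vi : v i != 0 by apply: v_neq0; move: ij; rewrite (negPf nij).
rewrite addr0; apply/eqP => /eqP; rewrite addr_eq0 => /eqP viE.
have := hdelta i s sd; rewrite -normrN -viE /e (negPf vi).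
by rewrite ltr_pMl ?normr_gt0 // ltrDl oppr_gt0 normr_lt0.
Qed.

(** A zero [v] in the closed polydisc is approached by shrinking it into the open one, where the
    previous lemma applies. Moving along the zero coordinates of [v] keeps this true, so Hurwitz
    gives a zero in the closed polydisc with all coordinates nonzero. *)
Lemma fill_punctures_closed (js : seq 'I_n) :
  (forall j, j \in js -> exists2 v, v j = 0 & G.@[v] != 0) ->
  (forall v, (forall i, `|v i| <= 1) -> (forall j, j \in js -> v j != 0) -> G.@[v] != 0) ->
  forall v, (forall i, `|v i| <= 1) -> G.@[v] != 0.
Proof.
move=> G_face G_neq0 v v1; apply/eqP => Gv.
have G_open : forall v, (forall i, `|v i| < 1) -> G.@[v] != 0.
  apply: (fill_punctures_open G_face) => u u1; apply: G_neq0 => i; exact: ltW.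
pose c i : C := (v i == 0)%:R.
pose x (m : nat) i : C := (1 - m.+2%:R^-1) * v i.
have xv i : tends_to (x^~ i) (v i).
  rewrite -[X in tends_to _ X]mul1r; apply: tends_toM; last exact: tends_to_cst.
  rewrite -[X in tends_to _ X]subr0 -[- 0]mulN1r.
  apply: tends_toD; first exact: tends_to_cst.
  apply: tends_to_ext (tends_toM (tends_to_cst (-1))
    (tends_to_subseq (phi := succn) (fun m => leqnSn m) (@tends_to_inv_succ R))) => m /=.
  by rewrite mulN1r.
suff /eqP[] : G.@[fun i => v i + 1 * c i] != 0.
  apply: (hurwitz_line (@ltr01 C) xv _ Gv) => m s s1; apply: G_open => i; rewrite /x /c.
  case: eqP => [->|_]; first by rewrite mulr0 add0r mulr1.
  have inv_lt1 : m.+2%:R^-1 < 1 :> C by rewrite invf_lt1 ?ltr0Sn // ltr1n.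
  rewrite mulr0 addr0 normrM ger0_norm ?subr_ge0 ?ltW //.
  apply: le_lt_trans (_ : 1 - m.+2%:R^-1 < 1); last by rewrite gtrBl invr_gt0 ltr0Sn.
  by rewrite ler_piMr // subr_ge0 ltW.
by apply: G_neq0 => i; rewrite /c mul1r; case: (v i =P 0) => [->|/eqP vi];
  rewrite ?add0r ?addr0 ?normr1 ?oner_eq0.
Qed.

End FillPunctures.

(** * Changing functionals and coordinates *)

Lemma prod_bool (K : comNzRingType) (n : nat) (b : 'I_n -> bool) :
  \prod_i (b i)%:R = [forall i, b i]%:R :> K.
Proof.
case: forallP => [h|/forallP]; first by rewrite big1 // => i _; rewrite h.
by rewrite negb_forall => /existsP[i /negPf bi]; rewrite (bigD1 i) //= bi mul0r.
Qed.

Section Transfer.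
Variables (K : comNzRingType) (n : nat) (J : Type) (s : seq J).

(** One index is exchanged at a time, the other factors being absorbed into the weights [d]. [P] is
    later nonvanishing, to reach the pairings, and vanishing, to reach coefficients from point
    evaluations. *)
Lemma functional_transfer (c : J -> K) (E : 'I_n -> (J -> K) -> Prop)
    (psi : 'I_n -> J -> K) (P : K -> Prop) :
  (forall i d, (forall phi, E i phi -> P (\sum_(j <- s) d j * phi j)) ->
     P (\sum_(j <- s) d j * psi i j)) ->
  (forall phi : 'I_n -> J -> K, (forall i, E i (phi i)) ->
     P (\sum_(j <- s) c j * \prod_i phi i j)) ->
  P (\sum_(j <- s) c j * \prod_i psi i j).
Proof.
move=> step base.
(* [r] lists the indices at which [phi] is already [psi]; the induction trades them back for
   functionals in [E]. *)
suff claim (r : seq 'I_n) (phi : 'I_n -> J -> K) :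
    (forall i, i \in r -> phi i = psi i) -> (forall i, i \notin r -> E i (phi i)) ->
    P (\sum_(j <- s) c j * \prod_i phi i j).
  by apply: (claim (enum 'I_n)) => // i; rewrite mem_enum.
elim: r phi => [|i r IH] phi hin hout; first by apply: base => i; apply: hout.
have [ir|nir] := boolP (i \in r).
  apply: IH => l lr; first by apply: hin; rewrite in_cons lr orbT.
  by apply: hout; rewrite in_cons negb_or lr andbT; apply: contraNneq lr => ->.
have split_i (x : J -> K) j :
   c j * \prod_l (if l == i then x else phi l) j = c j * \prod_(l | l != i) phi l j * x j.
  rewrite (bigD1 i) //= eqxx [x j * _]mulrC mulrA; congr (_ * _ * _).
  by apply: eq_bigr => l /negPf ->.
rewrite (eq_bigr (fun j => c j * \prod_(l | l != i) phi l j * psi i j)); last first.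
  move=> j _; rewrite -split_i; congr (_ * _); apply: eq_bigr => l _.
  by case: eqP => // ->; rewrite hin // mem_head.
apply: step => x Ex.
rewrite (eq_bigr (fun j => c j * \prod_l (if l == i then x else phi l) j)); last first.
  by move=> j _; rewrite split_i.
apply: (IH (fun l => if l == i then x else phi l)) => l lr.
  by case: eqP => [li|_]; [move: nir; rewrite -li lr | rewrite hin // in_cons lr orbT].
by case: eqP => [->//|/eqP li]; apply: hout; rewrite in_cons negb_or li.
Qed.

End Transfer.

(** * The one-variable apolar form and its behaviour in disc charts *)

Section Apolarity.
Variable K : numFieldType.
Implicit Types (p q : {poly K}) (c r u : K).

(** The one-variable apolar form on the monomials ['X^a] and ['X^b]. *)
Definition apolar_coef (k a b : nat) : K :=
  if (a + b == k)%N then (-1) ^+ a * a`!%:R * b`!%:R else 0.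

(** Its value at 0 is the one-variable apolar form; its constancy is the translation invariance of
    that form. *)
Definition transvectant (k : nat) p q : {poly K} :=
  \sum_(m < k.+1) (-1) ^+ m *: (p^`(m) * q^`(k - m)).

(** The product rule makes the sum telescope, and the two boundary terms contain a derivative of
    order [k.+1] of [p] or of [q]. *)
Lemma deriv_transvectant k p q : (size p <= k.+1)%N -> (size q <= k.+1)%N ->
  (transvectant k p q)^`() = 0.
Proof.
move=> szp szq.
pose g m : {poly K} := - ((-1) ^+ m *: (p^`(m) * q^`(k.+1 - m))).
rewrite /transvectant raddf_sum /=.
rewrite (eq_bigr (fun m : 'I_k.+1 => g m.+1 - g m)); last first.
  move=> m _; have mk : (m <= k)%N by rewrite -ltnS.
  by rewrite derivZ derivM -!derivnS /g subSS subSn // exprS mulN1r scaleNr !opprK scalerDr.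
rewrite -(big_mkord xpredT (fun m => g m.+1 - g m)) telescope_sumr // /g.
by rewrite (derivn_poly0 szp) subn0 (derivn_poly0 szq) mul0r mulr0 !scaler0 subrr.
Qed.

Lemma transvectant_cst k p q c : (size p <= k.+1)%N -> (size q <= k.+1)%N ->
  (transvectant k p q).[c] = (transvectant k p q).[0].
Proof.
move=> szp szq; have D := deriv_transvectant szp szq.
suff -> : transvectant k p q = ((transvectant k p q)`_0)%:P by rewrite !hornerC.
apply: size1_polyC; apply/leq_sizeP => -[//|m] _.
have := coef_deriv (transvectant k p q) m; rewrite D coef0 => /esym/eqP.
by rewrite mulrn_eq0 /= => /eqP.
Qed.

Lemma transvectantXn k a b c : (transvectant k 'X^a 'X^b).[c] =
  \sum_(m < k.+1) (-1) ^+ m * (a ^_ m)%:R * (b ^_ (k - m))%:R * (c ^+ (a - m) * c ^+ (b - (k - m))).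
Proof.
rewrite horner_sum; apply: eq_bigr => m _.
rewrite hornerZ hornerM !derivnXn !hornerMn !hornerXn -mulr_natr -[X in _ * (_ * X)]mulr_natr.
by rewrite mulrACA -!mulrA; congr (_ * _); rewrite mulrA mulrC -!mulrA.
Qed.

Lemma transvectantXn0 k a b : (transvectant k 'X^a 'X^b).[0] = apolar_coef k a b.
Proof.
rewrite transvectantXn /apolar_coef.
have zero m : (m < k.+1)%N -> (m == a) && (a + b == k)%N = false ->
   (-1) ^+ m * (a ^_ m)%:R * (b ^_ (k - m))%:R * (0 ^+ (a - m) * 0 ^+ (b - (k - m))) = 0 :> K.
  move=> mk h; have [am|am] := ltnP a m; first by rewrite ffact_small // mulr0 !mul0r.
  have [bm|bm] := ltnP b (k - m); first by rewrite [b ^_ _]ffact_small // mulr0 !mul0r.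
  rewrite -exprD expr0n; case: eqP => //= e; last by rewrite mulr0.
  by move: h; lia.
case: eqP => abk; last by apply: big1 => m _; apply: zero => //; lia.
have ak : (a < k.+1)%N by lia.
rewrite (bigD1 (Ordinal ak)) //= big1 => [|m ma]; last first.
  by apply: zero => //; apply/negbTE; rewrite negb_and; apply/orP; left; exact: ma.
have -> : (k - a = b)%N by lia.
by rewrite !subnn !ffactnn !expr0 !mulr1 addr0.
Qed.

Lemma coef_affine_exp c r a m :
  ((c%:P + r *: 'X) ^+ a)`_m = 'C(a, m)%:R * c ^+ (a - m) * r ^+ m.
Proof.
rewrite exprDn coef_sum.
rewrite (eq_bigr (fun i : 'I_a.+1 =>
    (nat_of_ord i == m)%:R * ('C(a, m)%:R * c ^+ (a - m) * r ^+ m))); last first.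
  move=> i _; rewrite coefMn -rmorphXn /= coefCM exprZn coefZ coefXn.
  case: (eqVneq m i) => [->|_]; last by rewrite !mulr0 mul0rn mul0r.
  by rewrite mul1r mulr1 -[LHS]mulr_natl mulrA.
rewrite -mulr_suml; have [ma|ma] := ltnP m a.+1; last first.
  by rewrite bin_small // !mul0r mulr0.
rewrite (bigD1 (Ordinal ma)) //= eqxx big1 ?addr0 ?mul1r // => i im.
by case: eqP => // e; move/eqP: im => []; apply: val_inj.
Qed.

(* The charts [u |-> c + r u] and [u |-> c + r / u] map the unit disc onto a
   disc and onto the exterior of a disc (with [infinity] in place of [u = 0]);
   [chart] is [X^a] in such a chart, homogenized with respect to degree [k]. *)
Definition chart (ext : bool) c r (k a : nat) : {poly K} :=
  if ext then (r%:P + c *: 'X) ^+ a * 'X^(k - a) else (c%:P + r *: 'X) ^+ a.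

Definition chart_point (ext : bool) c r u : K :=
  if ext then c + r / u else c + r * u.

Lemma size_affine_exp c r a : (size ((c%:P + r *: 'X) ^+ a) <= a.+1)%N.
Proof.
by apply/leq_sizeP => m am; rewrite coef_affine_exp bin_small // !mul0r.
Qed.

Lemma size_chart ext c r k a : (a <= k)%N -> (size (chart ext c r k a) <= k.+1)%N.
Proof.
move=> ak; rewrite /chart; case: ext; last by rewrite (leq_trans (size_affine_exp _ _ _)).
apply: leq_trans (size_polyMleq _ _) _; rewrite size_polyXn addnS /=.
by apply: leq_trans (leq_add (size_affine_exp _ _ _) (leqnn _)) _; rewrite addSn subnKC.
Qed.

Lemma horner_chart (ext : bool) c r k a u : (a <= k)%N -> (ext -> u != 0) ->
  (chart ext c r k a).[u] = (if ext then u ^+ k else 1) * chart_point ext c r u ^+ a.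
Proof.
move=> ak; rewrite /chart /chart_point; case: ext => [/(_ isT) u_neq0|_]; last first.
  by rewrite horner_exp hornerD hornerC hornerZ hornerX mul1r.
rewrite hornerM hornerXn horner_exp hornerD hornerC hornerZ hornerX.
have -> : r + c * u = u * (c + r / u) by field.
by rewrite exprMn -{2}(subnKC ak) exprD; ring.
Qed.

Lemma coef_chart_disc c r k a m :
  (chart false c r k a)`_m = 'C(a, m)%:R * c ^+ (a - m) * r ^+ m.
Proof. exact: coef_affine_exp. Qed.

(** The exterior chart is the reversal, in degree [k], of the disc chart. *)
Lemma coef_chart_ext c r k b m : (b <= k)%N -> (m <= k)%N ->
  (chart true c r k b)`_m = 'C(b, k - m)%:R * c ^+ (b - (k - m)) * r ^+ (k - m).
Proof.
move=> bk mk; rewrite /chart coefMXn; case: ltnP => h.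
  by rewrite bin_small ?mul0r //; lia.
rewrite coef_affine_exp.
have kb : (k - m <= b)%N by lia.
have -> : (m - (k - b) = b - (k - m))%N by lia.
by rewrite bin_sub // subKn //; ring.
Qed.

End Apolarity.

(** The transvectant may be evaluated at the centre [c] instead of 0. There its terms are products
    of Taylor coefficients, which the two charts list in opposite orders; the powers of [r] combine
    to [r ^+ k]. *)
Lemma grace_pairing_charts (K : numClosedFieldType) (ext : bool) (c r : K) (k : nat) :
  r != 0 -> exists2 kappa : K, kappa != 0 & forall a b, (a <= k)%N -> (b <= k)%N ->
    grace_pairing k (chart ext c r k a) (chart (~~ ext) c r k b) = kappa * apolar_coef K k a b.
Proof.
move=> r_neq0.
have fact_neq0 m : m`!%:R != 0 :> K by rewrite pnatr_eq0 -lt0n fact_gt0.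
have disc a b : (a <= k)%N -> (b <= k)%N ->
    grace_pairing k (chart false c r k a) (chart true c r k b) =
    r ^+ k / k`!%:R * apolar_coef K k a b.
  move=> ak bk; rewrite -transvectantXn0 -(@transvectant_cst _ _ _ _ c) ?size_polyXn //.
  rewrite transvectantXn mulr_sumr; apply: eq_bigr => m _.
  have mk : (m <= k)%N by rewrite -ltnS.
  rewrite coef_chart_disc coef_chart_ext // -!bin_ffact !natrM.
  have -> : r ^+ k = r ^+ m * r ^+ (k - m) by rewrite -exprD subnKC.
  rewrite -(bin_fact mk) !natrM.
  have b_neq0 : 'C(k, m)%:R != 0 :> K by rewrite pnatr_eq0 -lt0n bin_gt0.
  move: b_neq0 (fact_neq0 m) (fact_neq0 (k - m)%N).
  move: ('C(k, m)%:R) ('C(a, m)%:R) ('C(b, k - m)%:R) (m`!%:R) ((k - m)`!%:R).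
  move: (r ^+ m) (r ^+ (k - m)) (c ^+ (a - m)) (c ^+ (b - (k - m))) ((-1) ^+ m) => x1 x2 x3 x4 x5.
  by move=> y1 y2 y3 y4 y5 n1 n4 n5; field; rewrite n1 n4 n5.
case: ext.
  (* Exchanging the arguments of [apolar_coef] costs [(-1)^k], since it vanishes unless
     [a + b = k]. *)
  exists ((-1) ^+ k * (r ^+ k / k`!%:R)).
    by rewrite mulf_neq0 ?signr_eq0 // mulf_neq0 ?invr_eq0 ?expf_neq0.
  move=> a b ak bk.
  have -> : grace_pairing k (chart true c r k a) (chart (~~ true) c r k b) =
     grace_pairing k (chart false c r k b) (chart true c r k a).
    by apply: eq_bigr => m _; rewrite [X in X / _]mulrAC.
  rewrite disc // [RHS]mulrAC [RHS]mulrC; congr (_ * _); rewrite /apolar_coef addnC.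
  case: eqP => [<-|]; last by rewrite mulr0.
  have -> : (-1) ^+ b = (-1) ^+ (a + b) * (-1) ^+ a :> K.
    by rewrite exprD mulrAC -expr2 sqrr_sign mul1r.
  by rewrite -!mulrA [b`!%:R * _]mulrC.
exists (r ^+ k / k`!%:R); last exact: disc.
by rewrite mulf_neq0 ?invr_eq0 ?expf_neq0.
Qed.

Lemma poly_eq0_off_point (K : numFieldType) (p : {poly K}) (c : K) :
  (forall x, x != c -> p.[x] = 0) -> p = 0.
Proof.
(* The linear factor takes care of the exceptional point; then the natural numbers provide more
   roots than the degree allows. *)
move=> hp; pose q := p * ('X - c%:P).
have q0 x : q.[x] = 0.
  rewrite hornerM hornerXsubC; have [->|/hp ->] := eqVneq x c; last by rewrite mul0r.
  by rewrite subrr mulr0.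
suff /eqP : q = 0 by rewrite mulf_eq0 polyXsubC_eq0 orbF => /eqP.
apply: (@roots_geq_poly_eq0 _ _ [seq i%:R | i <- iota 0 (size q)]).
- by apply/allP => x _; rewrite rootE q0.
- rewrite map_inj_uniq ?iota_uniq // => i j /eqP; rewrite eqr_nat; exact: eqP.
by rewrite size_map size_iota.
Qed.

(** * Monomial expansions: coefficients, derivatives at the origin, degrees *)

Lemma msupp_expand (K : nzRingType) (n : nat) (f : {mpoly K[n]}) (m : 'X_{1..n}) :
  f@_m = \sum_(a <- msupp f) f@_a * (a == m)%:R.
Proof.
by rewrite {1}[f]mpolyE raddf_sum; apply: eq_bigr => a _; rewrite /= mcoeffZ mcoeffX.
Qed.

Lemma meval_at0 (K : comNzRingType) (n : nat) (f : {mpoly K[n]}) : f.@[fun=> 0] = f@_0%MM.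
Proof.
rewrite mevalE msupp_expand; apply: eq_bigr => a _; congr (_ * _).
rewrite (eq_bigr (fun i => (a i == 0%N)%:R)) => [|i _]; last by rewrite expr0n.
rewrite prod_bool; congr (_%:R); congr nat_of_bool; apply/forallP/eqP => [h|-> i].
  by apply/mnmP => i; rewrite mnmE; apply/eqP.
by rewrite mnmE.
Qed.

Lemma mderivm_at0 (K : comNzRingType) (n : nat) (f : {mpoly K[n]}) (a : 'X_{1..n}) :
  (f^`M[a]).@[fun=> 0] = f@_a * (\prod_i (a i)`!)%:R.
Proof.
rewrite meval_at0 mcoeff_mderivm addm0 mulr_natr; congr (_ *+ _).
by apply: eq_bigr => i _; rewrite ffactnn.
Qed.

Section Degrees.
Variables (R : realType) (n : nat).
Implicit Types (f : {mpoly R[i][n]}) (k : 'X_{1..n}).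

Lemma deg_bounded_msupp k f m i : deg_bounded k f -> m \in msupp f -> (m i <= k i)%N.
Proof.
by move=> hf mf; apply: leq_trans (hf i);
  exact: (@leq_bigmax_seq _ _ xpredT (fun m : 'X_{1..n} => m i) _ mf).
Qed.

Lemma deg_in_attained f i : f != 0 -> exists2 m, m \in msupp f & m i = deg_in i f.
Proof.
rewrite -msupp_eq0 /deg_in; elim: (msupp f) => // m s IH _; rewrite big_cons.
have [->|/IH[m' m's m'E]] := eqVneq s [::].
  by exists m; rewrite ?mem_head // big_nil maxn0.
case: (leqP (m i) (\max_(j <- s) j i)) => _.
  by exists m' => //; rewrite in_cons m's orbT.
by exists m; rewrite ?mem_head.
Qed.

(** Brings the form into the shape of [functional_transfer]: on a pair of monomials it factors over
    the variables. *)
Lemma apolar_formE k f g : deg_bounded k f ->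
  apolar_form k f g = \sum_(t <- [seq (a, b) | a <- msupp f, b <- msupp g])
    f@_t.1 * g@_t.2 * \prod_i apolar_coef R[i] (k i) (t.1 i) (t.2 i).
Proof.
move=> hf; pose fac (m : 'X_{1..n}) : R[i] := (\prod_i (m i)`!)%:R.
pose W (a : 'X_{1..n}) : R[i] := (-1) ^+ mdeg a * fac a * (g@_(k - a)%MM * fac (k - a)%MM).
have coefE (a b : 'X_{1..n}) : (a <= k)%MM ->
    \prod_i apolar_coef R[i] (k i) (a i) (b i) =
    (b == k - a)%MM%:R * ((-1) ^+ mdeg a * fac a * fac b).
  move=> /mnm_lepP ak.
  rewrite (eq_bigr (fun i => (a i + b i == k i)%N%:R *
      ((-1) ^+ a i * ((a i)`!%:R * (b i)`!%:R)))) => [|i _]; last first.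
    by rewrite /apolar_coef; case: eqP; rewrite ?mul1r ?mul0r ?mulrA.
  rewrite !big_split /= prod_bool mdegE -prodrXr -!natr_prod; congr (_ * _); last by rewrite mulrA.
  congr (_%:R); congr nat_of_bool; apply/forallP/eqP => [h|-> i].
    by apply/mnmP => i; rewrite mnmBE -(eqP (h i)) addKn.
  by rewrite mnmBE subnKC.
transitivity (\sum_(a <- msupp f) f@_a * W a).
  rewrite /apolar_form.
  rewrite (eq_bigr (fun a : 'X_{1..n < (mdeg k).+1} =>
    \sum_(m <- msupp f) f@_m * (m == a :> 'X_{1..n})%:R * W a)) => [|a _]; last first.
    by rewrite -mulr_suml -msupp_expand !mderivm_at0 /W /fac; ring.
  rewrite exchange_big /= big_seq [RHS]big_seq; apply: eq_bigr => m mf.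
  have mk : (m <= k)%MM by apply/mnm_lepP => i; apply: deg_bounded_msupp mf.
  have mdegm : (mdeg m < (mdeg k).+1)%N.
    by rewrite ltnS !mdegE; apply: leq_sum => i _; apply: deg_bounded_msupp mf.
  rewrite (bigD1 (BMultinom mdegm)) //= eqxx mulr1 big1 ?addr0 // => a /andP[_ am].
  case: eqP => [ma|_]; last by rewrite mulr0 mul0r.
  by case/eqP: am; apply: val_inj => /=; rewrite -ma.
rewrite big_allpairs_dep /= big_seq [RHS]big_seq; apply: eq_bigr => m mf.
have mk : (m <= k)%MM by apply/mnm_lepP => i; apply: deg_bounded_msupp mf.
rewrite /W (msupp_expand g) mulr_suml !mulr_sumr; apply: eq_bigr => b _.
rewrite coefE //; case: eqP => [->|_]; last by rewrite !(mulr0, mul0r).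
by ring.
Qed.

End Degrees.

(** * Polynomials in chart coordinates *)

Section Pullback.
Variables (K : numFieldType) (n : nat) (ext : 'I_n -> bool) (c r : 'I_n -> K).
Variable k : 'X_{1..n}.

(** [f] in chart coordinates, with the denominators [u_i ^+ k i] cleared monomial by monomial, so
    that [u_i = 0] is allowed. *)
Definition pullback (f : {mpoly K[n]}) : {mpoly K[n]} :=
  \sum_(m <- msupp f) f@_m *:
    \prod_i (map_poly (@mpolyC n K) (chart (ext i) (c i) (r i) (k i) (m i))).['X_i].

Lemma meval_pullback f u : (pullback f).@[u] =
  \sum_(m <- msupp f) f@_m * \prod_i (chart (ext i) (c i) (r i) (k i) (m i)).[u i].
Proof.
rewrite raddf_sum; apply: eq_bigr => m _ /=; rewrite mevalZ rmorph_prod /=.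
congr (_ * _); apply: eq_bigr => i _.
rewrite -horner_map -map_poly_comp /= mevalXU; congr (_.[_]).
by apply: map_poly_id => x _; rewrite /= mevalC.
Qed.

Lemma meval_pullback_point f u : (forall m i, m \in msupp f -> (m i <= k i)%N) ->
  (forall i, ext i -> u i != 0) ->
  (pullback f).@[u] = (\prod_i if ext i then u i ^+ k i else 1) *
    f.@[fun i => chart_point (ext i) (c i) (r i) (u i)].
Proof.
move=> fk u_neq0; rewrite meval_pullback mevalE mulr_sumr big_seq [RHS]big_seq.
apply: eq_bigr => m mf; rewrite mulrCA -big_split /=; congr (_ * _).
by apply: eq_bigr => i _; rewrite horner_chart ?fk //; apply: u_neq0.
Qed.

(** Chart points with [v != 0] reach every [x != c0], so the combination of the ['X^(a j)] vanishes
    off one point and is the zero polynomial. *)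
Lemma chart_separates (J : eqType) (s : seq J) (d : J -> K) (a : J -> nat) (a0 k0 : nat)
    (e : bool) (c0 r0 : K) : r0 != 0 -> {in s, forall j, (a j <= k0)%N} ->
  (forall v, \sum_(j <- s) d j * (chart e c0 r0 k0 (a j)).[v] = 0) ->
  \sum_(j <- s) d j * (a j == a0)%:R = 0.
Proof.
move=> r_neq0 ak h; pose p : {poly K} := \sum_(j <- s) d j *: 'X^(a j).
suff p0 : p = 0.
  have := coef0 K a0; rewrite -p0 coef_sum => {2}<-.
  by apply: eq_bigr => j _; rewrite coefZ coefXn eq_sym.
apply: (@poly_eq0_off_point _ _ c0) => x xc.
have xc_neq0 : x - c0 != 0 by rewrite subr_eq0.
pose v := if e then r0 / (x - c0) else (x - c0) / r0.
have v_neq0 : v != 0 by rewrite /v; case: ifP => _; rewrite mulf_neq0 ?invr_eq0.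
have vx : chart_point e c0 r0 v = x.
  by rewrite /chart_point /v; case: (e); field; rewrite ?xc_neq0 ?r_neq0.
have := h v; rewrite big_seq (eq_bigr (fun j => (if e then v ^+ k0 else 1) * (d j * x ^+ a j))).
  rewrite -big_seq -mulr_sumr => /eqP; rewrite mulf_eq0; case/orP.
    by case: ifP => _; rewrite ?expf_eq0 ?(negPf v_neq0) ?andbF ?oner_eq0.
  by move/eqP => <-; rewrite horner_sum; apply: eq_bigr => j _; rewrite hornerZ hornerXn.
by move=> j js; rewrite horner_chart ?ak // vx mulrCA.
Qed.

(** On the face [v j = 0] only monomials of full degree [k j] survive. Were the pullback zero there,
    exchanging evaluations for coefficient extraction would make the coefficient of [m0] vanish. *)
Lemma pullback_face f j m0 : (forall i, r i != 0) ->
  (forall m i, m \in msupp f -> (m i <= k i)%N) ->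
  ext j -> m0 \in msupp f -> m0 j = k j ->
  exists2 v, v j = 0 & (pullback f).@[v] != 0.
Proof.
move=> r_neq0 fk extj m0f m0j; apply: boolp.contrapT => face0.
have {}face0 v : v j = 0 -> (pullback f).@[v] = 0.
  by move=> vj; apply/eqP/negPn/negP => h; apply: face0; exists v.
suff : \sum_(m <- msupp f) f@_m * \prod_i (m i == m0 i)%:R = 0.
  rewrite (eq_bigr (fun m => f@_m * (m == m0)%:R)) => [|m _].
    by rewrite -msupp_expand; apply/eqP; rewrite mcoeff_eq0 m0f.
  rewrite prod_bool; congr (_ * _); congr (_%:R); congr nat_of_bool.
  by apply/forallP/eqP => [h|-> //]; apply/mnmP => i; apply/eqP.
pose E i (phi : 'X_{1..n} -> K) := exists v, (i = j -> v = 0) /\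
  phi = fun m => (chart (ext i) (c i) (r i) (k i) (m i)).[v].
apply: (functional_transfer (E := E) (psi := fun i m => (m i == m0 i)%:R)
  (P := fun x => x = 0)) => [i d h|phi hphi].
  have [ij|/eqP ij] := eqVneq i j; last first.
    apply: (@chart_separates _ _ d (fun m => m i) _ _ _ _ _ (r_neq0 i)) => [m mf|v].
      exact: fk.
    by apply: h; exists v.
  (* For index [j], evaluation at 0 is itself [r j ^+ k j] times extraction of the degree [k j]. *)
  have := h (fun m => (chart (ext i) (c i) (r i) (k i) (m i)).[0])
    (ex_intro _ 0 (conj (fun=> erefl) erefl)).
  rewrite ij extj m0j big_seq (eq_bigr (fun m => (d m * (m j == k j)%:R) * r j ^+ k j)).
    rewrite -big_seq -mulr_suml => /eqP; rewrite mulf_eq0 expf_eq0 (negPf (r_neq0 j)) andbF orbF.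
    by move/eqP.
  move=> m /(fk _ j) mk; rewrite /chart hornerM hornerXn horner_exp hornerD hornerC hornerZ hornerX.
  rewrite mulr0 addr0 expr0n subn_eq0 -mulrA; congr (_ * _).
  case: eqP => [->|/eqP mj]; first by rewrite leqnn mul1r mulr1.
  by rewrite leqNgt ltn_neqAle mj mk mul0r mulr0.
have [v hv] := boolp.choice hphi.
rewrite -[RHS](face0 v); last by case: (hv j) => /(_ erefl).
rewrite meval_pullback; apply: eq_bigr => m _; congr (_ * _); apply: eq_bigr => i _.
by case: (hv i) => _ ->.
Qed.

End Pullback.

(** * From zero-free pullbacks to a nonzero apolar form *)

Section Main.
Variables (R : realType) (n : nat) (ext : 'I_n -> bool) (c r : 'I_n -> R[i]).
Variable k : 'X_{1..n}.
Hypothesis r_neq0 : forall i, r i != 0.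
Let F := pullback ext c r k.
Let G := pullback (fun i => ~~ ext i) c r k.

Lemma apolar_form_neq0 (f g : {mpoly R[i][n]}) (rho : R[i]) :
  deg_bounded k f -> deg_bounded k g -> 1 < rho ->
  (forall u, (forall i, `|u i| < 1) -> (F f).@[u] != 0) ->
  (forall v, (forall i, `|v i| < rho) -> (G g).@[v] != 0) ->
  apolar_form k f g != 0.
Proof.
move=> hf hg rho_gt1 F_neq0 G_neq0; rewrite (apolar_formE _ hf).
set s := [seq _ | _ <- _, _ <- _].
have sP t i : t \in s -> (t.1 i <= k i)%N /\ (t.2 i <= k i)%N.
  by case/allpairsP => -[a b] /= [af bg ->];
    split; [exact: deg_bounded_msupp hf af | exact: deg_bounded_msupp hg bg].
pose E i (phi : 'X_{1..n} * 'X_{1..n} -> R[i]) := exists w : R[i] * R[i],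
  [/\ `|w.1| < 1, `|w.2| < rho & phi = fun t =>
   (chart (ext i) (c i) (r i) (k i) (t.1 i)).[w.1] *
   (chart (~~ ext i) (c i) (r i) (k i) (t.2 i)).[w.2]].
apply: (functional_transfer (c := fun t => f@_t.1 * g@_t.2) (E := E)
  (psi := fun i t => apolar_coef R[i] (k i) (t.1 i) (t.2 i))
  (P := fun x => x != 0)) => [i d h|phi hphi].
  have [kappa kappa_neq0 hk] := grace_pairing_charts (ext i) (c i) (k i) (r_neq0 i).
  (* The weights [d] carry the other indices; [Q] is the two-variable polynomial left in index
     [i]. *)
  pose Q := [seq (d t *: chart (ext i) (c i) (r i) (k i) (t.1 i),
    chart (~~ ext i) (c i) (r i) (k i) (t.2 i)) | t <- s].
  have := @disc_grace _ (k i) Q rho rho_gt1.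
  have -> : \sum_(t <- Q) grace_pairing (k i) t.1 t.2 =
     kappa * \sum_(t <- s) d t * apolar_coef R[i] (k i) (t.1 i) (t.2 i).
    rewrite big_map mulr_sumr big_seq [RHS]big_seq; apply: eq_bigr => t /(sP _ i)[t1 t2].
    by rewrite grace_pairingZl hk // mulrCA.
  rewrite mulf_eq0 negb_or kappa_neq0 /=; apply.
    move=> _ /mapP[t /(sP _ i) [t1 t2] ->] /=.
    by rewrite (leq_trans (size_scale_leq _ _)) ?size_chart.
  move=> z w z1 wrho; rewrite /tensor_eval big_map.
  rewrite (eq_bigr (fun t => d t * ((chart (ext i) (c i) (r i) (k i) (t.1 i)).[z] *
    (chart (~~ ext i) (c i) (r i) (k i) (t.2 i)).[w]))).
    by apply: h; exists (z, w).
  by move=> t _; rewrite /= hornerZ mulrA.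
have [w hw] := boolp.choice hphi.
have -> : \sum_(t <- s) f@_t.1 * g@_t.2 * \prod_i phi i t =
   (F f).@[fun i => (w i).1] * (G g).@[fun i => (w i).2].
  rewrite !meval_pullback big_allpairs_dep /= mulr_suml; apply: eq_bigr => a _.
  rewrite mulr_sumr; apply: eq_bigr => b _; rewrite mulrACA -big_split /=.
  by congr (_ * _); apply: eq_bigr => i _; case: (hw i) => _ _ ->.
by rewrite mulf_neq0 ?F_neq0 ?G_neq0 // => i; case: (hw i).
Qed.

End Main.

(** * Stability of a polynomial as nonvanishing of its pullback *)

Section PullbackStable.
Variables (R : realType) (n : nat) (ext : 'I_n -> bool) (c r : 'I_n -> R[i]).
Variables (k : 'X_{1..n}) (S : 'I_n -> set R[i]) (f : {mpoly R[i][n]}).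
Hypothesis r_neq0 : forall i, r i != 0.
Hypothesis hf : deg_bounded k f.
Hypothesis f_stable : stable (set_prod S) f.
Let js := [seq j <- enum 'I_n | ext j].

Lemma pullback_neq0_punctured (u : 'I_n -> R[i]) :
  (forall i, (ext i -> u i != 0) -> S i (chart_point (ext i) (c i) (r i) (u i))) ->
  (forall j, j \in js -> u j != 0) -> (pullback ext c r k f).@[u] != 0.
Proof.
move=> uS u_neq0.
have {}u_neq0 i : ext i -> u i != 0.
  by move=> ei; apply: u_neq0; rewrite mem_filter ei mem_enum.
rewrite meval_pullback_point //; last by move=> m i; apply: deg_bounded_msupp.
rewrite mulf_neq0 //; last by apply: f_stable => i; apply: uS; apply: u_neq0.
apply/prodf_neq0 => i _; case: ifP => ei; last exact: oner_neq0.
by rewrite expf_neq0 // u_neq0.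
Qed.

Lemma pullback_face_neq0 (j : 'I_n) : f != 0 -> (forall i, ext i -> deg_in i f = k i) ->
  j \in js -> exists2 v, v j = 0 & (pullback ext c r k f).@[v] != 0.
Proof.
move=> f_neq0 f_deg; rewrite mem_filter => /andP[ej _].
have [m mf mj] := deg_in_attained j f_neq0.
have fk m' i : m' \in msupp f -> (m' i <= k i)%N by apply: deg_bounded_msupp.
refine (pullback_face c r_neq0 fk ej mf _).
by rewrite mj f_deg.
Qed.

Lemma stable_neq0 (z : 'I_n -> R[i]) : (forall i, S i (z i)) -> f != 0.
Proof. by move=> /f_stable; apply: contraNneq => ->; rewrite meval0. Qed.

Lemma pullback_neq0_open :
  (forall i u, `|u| < 1 -> (ext i -> u != 0) -> S i (chart_point (ext i) (c i) (r i) u)) ->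
  (forall i, ext i -> deg_in i f = k i) ->
  forall u, (forall i, `|u i| < 1) -> (pullback ext c r k f).@[u] != 0.
Proof.
move=> hS f_deg.
(* The zero polynomial has degree 0 and could meet the degree condition; it is excluded by stability
   at a point of the domain. The chart coordinate 1/2 lies in the open disc and avoids the
   puncture. *)
have f_neq0 : f != 0.
  apply: (@stable_neq0 (fun i => chart_point (ext i) (c i) (r i) 2^-1)) => i.
  by apply: hS => [|_]; rewrite ?invr_eq0 ?pnatr_eq0 //
    ger0_norm ?invf_lt1 ?ltr1n ?invr_ge0 ?ler0n ?ltr0n.
apply: fill_punctures_open (fun j => pullback_face_neq0 f_neq0 f_deg) _ => u u1.
by apply: pullback_neq0_punctured => i; apply: hS.
Qed.

Lemma pullback_neq0_closed :
  (forall i u, `|u| <= 1 -> (ext i -> u != 0) -> S i (chart_point (ext i) (c i) (r i) u)) ->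
  (forall i, ext i -> deg_in i f = k i) ->
  forall u, (forall i, `|u i| <= 1) -> (pullback ext c r k f).@[u] != 0.
Proof.
move=> hS f_deg.
have f_neq0 : f != 0.
  apply: (@stable_neq0 (fun i => chart_point (ext i) (c i) (r i) 1)) => i.
  by apply: hS => [|_]; rewrite ?oner_eq0 ?normr1.
apply: fill_punctures_closed (fun j => pullback_face_neq0 f_neq0 f_deg) _ => u u1.
by apply: pullback_neq0_punctured => i; apply: hS.
Qed.

End PullbackStable.

(** * Charts adapted to the given discs and exteriors *)

Lemma chart_point_dist (K : numFieldType) (ext : bool) (c r u : K) : 0 < r ->
  `|chart_point ext c r u - c| = if ext then r / `|u| else r * `|u|.
Proof.
by move=> r_gt0; rewrite /chart_point; case: ext;
  rewrite addrC addKr normrM ?normfV (gtr0_norm r_gt0).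
Qed.

Local Open Scope complex_scope.
Local Open Scope classical_set_scope.

Theorem theorem4p2 (R : realType) (n : nat) (hn : (1 <= n)%N)
    (C : 'I_n -> set R[i])
    (hC : forall i, is_open_disc (C i) \/ is_disc_exterior (C i))
    (k : 'X_{1..n}) (f g : {mpoly R[i][n]})
    (hf : deg_bounded k f) (hg : deg_bounded k g)
    (f_stable : stable (set_prod C) f)
    (f_deg : forall j, is_disc_exterior (C j) -> deg_in j f = k j)
    (g_stable : stable (set_prod (fun i => ~` C i)) g)
    (g_deg : forall j, is_open_disc (C j) -> deg_in j g = k j) :
  apolar_form k f g != 0.
Proof.
have hC' i : exists p : bool * (R[i] * R), 0 < p.2.2 /\
    C i = if p.1 then [set z | p.2.2%:C < `|z - p.2.1|] else [set z | `|z - p.2.1| < p.2.2%:C].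
  by case: (hC i) => -[c [r [r_gt0 ->]]]; [exists (false, (c, r)) | exists (true, (c, r))].
have [p hp] := boolp.choice hC'.
pose ext i := (p i).1; pose c i := (p i).2.1; pose r i : R[i] := (p i).2.2%:C.
have r_gt0 i : 0 < r i by rewrite /r ltcR; case: (hp i).
have r_neq0 i : r i != 0 by rewrite gt_eqF.
have CE i z : C i z <-> if ext i then r i < `|z - c i| else `|z - c i| < r i.
  by rewrite /ext /r /c; have [_ ->] := hp i; case: (p i).1.
have C_ext i : ext i -> is_disc_exterior (C i).
  by rewrite /ext; have [h ->] := hp i => ->; exists (p i).2.1, (p i).2.2.
have C_disc i : ~~ ext i -> is_open_disc (C i).
  by rewrite /ext; have [h ->] := hp i => /negPf ->; exists (p i).2.1, (p i).2.2.
have F_neq0 : forall u, (forall i, `|u i| < 1) -> (pullback ext c r k f).@[u] != 0.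
  apply: (pullback_neq0_open r_neq0 hf f_stable) => [i u u1 u_neq0|i /C_ext]; last exact: f_deg.
  apply/CE; rewrite chart_point_dist //; case: (ext i) u_neq0 => [/(_ isT) u_neq0|_].
    by rewrite ltr_pdivlMr ?normr_gt0 // gtr_pMr.
  by rewrite gtr_pMr.
(* The complements contain the boundary circles, so in the exchanged charts stability of [g] reaches
   the closed polydisc. *)
have G_neq0 : forall u, (forall i, `|u i| <= 1) ->
    (pullback (fun i => ~~ ext i) c r k g).@[u] != 0.
  apply: (pullback_neq0_closed r_neq0 hg g_stable) => [i u u1 u_neq0|i /C_disc]; last exact: g_deg.
  move=> /CE; rewrite chart_point_dist //; case: (ext i) u_neq0 => [_|/(_ isT) u_neq0] /=.
    by rewrite ltr_pMr // le_gtF.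
  rewrite ltr_pdivrMr ?normr_gt0 // ltr_pMr // => /lt_le_trans/(_ u1).
  by rewrite ltxx.
have [rho rho_gt1 G_neq0'] := closed_polydisc_open_nbhd G_neq0.
exact: (apolar_form_neq0 r_neq0 hf hg rho_gt1 F_neq0 G_neq0').
Qed.
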